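(* If $X$ is a Urysohn space, then $|X|\leq Upsw(X)^{\theta\text{-}aL_{c}(X)\,\psi(X)}$.
   Context: A space $X$ is Urysohn if for every two distinct points $x,y\in X$ there are open sets $U\ni x$ and $V\ni y$ with $\overline{U}\cap\overline{V}=\emptyset$. For $A\subseteq X$, the $\theta$-closure is $cl_{\theta}(A)=\{x\in X:\ \overline{U}\cap A\neq\emptyset \text{ for every open neighborhood } U \text{ of } x\}$. A Urysohn point separating open cover of $X$ is an open cover $\mathcal{S}$ of $X$ such that for any distinct points $x,y\in X$ there is $S\in\mathcal{S}$ with $x\in S$ and $y\notin cl_{\theta}(\overline{S})$. The Urysohn point separating weight of a Urysohn space $X$ is $$Upsw(X)=\min\{\tau: X\text{ has a Urysohn point separating open cover }\mathcal{S}\text{ such that each point of }X\text{ is in at most }\tau\text{ elements of }\mathcal{S}\}+\aleph_0.$$ For $Y\subseteq X$, $\theta\text{-}aL(Y,X)$ is the least cardinal $\kappa$ such that every cover $\mathcal{V}$ of $Y$ by open subsets of $X$ has a subfamily $\mathcal{V}'\subseteq\mathcal{V}$ with $|\mathcal{V}'|\leq\kappa$ and $Y\subseteq\bigcup\{cl_{\theta}(\overline{V}):V\in\mathcal{V}'\}$, where closures and $\theta$-closures are taken in $X$. Further, $\theta\text{-}aL_{c}(X)=\sup\{\theta\text{-}aL(C,X):C\subseteq X\text{ is closed}\}$. $\psi(X)$ is the pseudocharacter of $X$. Convention: the cardinal functions $\theta\text{-}aL_c$ and $\psi$ are taken to be infinite-valued (i.e. $\aleph_0$ is added: $\theta\text{-}aL_{c}(X)$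 stands for $\aleph_0+\sup\{\theta\text{-}aL(C,X):C\subseteq X\text{ is closed}\}$, and $\psi(X)$ stands for $\aleph_0$ plus the supremum over $x\in X$ of the least cardinality of a family of open neighborhoods of $x$ whose intersection is $\{x\}$). *)

(* Defs.v *)
From HB Require Import structures.
From mathcomp Require Import all_boot all_classical topology.

Set Implicit Arguments.
Unset Strict Implicit.
Unset Printing Implicit Defensive.

Local Open Scope classical_set_scope.
Local Open Scope card_scope.

(* A cardinal is represented by any type of that cardinality: cardinals are
   compared with [#<=] and [#=] on full sets, and cardinal addition,
   multiplication and exponentiation are [+], [*] and [->] on types. *)

(* A type of the least cardinality among the types satisfying P; the value is
   the empty type when there is none, i.e., by [card_minP], when no
   type satisfies P (for a P invariant under equipotence). *)
Definition is_card_min (P : Type -> Prop) (K : Type) :=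
  P K /\ forall L : Type, P L -> [set: K] #<= [set: L].

Definition card_min (P : Type -> Prop) : Type :=
  if pselect (exists K, is_card_min P K) is left e then projT1 (cid e)
  else void.

Definition card_sup (I : Type) (D : set I) (F : I -> Type) : Type :=
  card_min (fun K => forall i, D i -> [set: F i] #<= [set: K]).

Definition urysohn_space (X : topologicalType) :=
  forall x y : X, x <> y ->
    exists U V : set X, [/\ open_nbhs x U, open_nbhs y V &
      closure U `&` closure V = set0].

Definition theta_closure (X : topologicalType) (A : set X) : set X :=
  [set x | forall U : set X, open_nbhs x U -> closure U `&` A !=set0].

Definition urysohn_point_separating_open_cover
    (X : topologicalType) (S : set (set X)) :=
  [/\ S `<=` open,
      \bigcup_(U in S) U = setT &
      forall x y : X, x <> y ->
        exists U : set X, [/\ S U, U x & ~ theta_closure (closure U) y]].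

Definition Upsw_bound (X : topologicalType) (K : Type) :=
  exists S : set (set X), urysohn_point_separating_open_cover S /\
    forall x : X, [set U | S U /\ U x] #<= [set: K].

Definition Upsw (X : topologicalType) : Type :=
  (card_min (@Upsw_bound X) + nat)%type.

Definition theta_aL_bound (X : topologicalType) (Y : set X) (K : Type) :=
  forall V : set (set X), V `<=` open -> Y `<=` \bigcup_(U in V) U ->
    exists W : set (set X), [/\ W `<=` V, W #<= [set: K] &
      Y `<=` \bigcup_(U in W) theta_closure (closure U)].

Definition theta_aL (X : topologicalType) (Y : set X) : Type :=
  card_min (theta_aL_bound Y).

Definition theta_aLc (X : topologicalType) : Type :=
  (nat + card_sup [set C : set X | closed C] (@theta_aL X))%type.

Definition pseudocharacter_size (X : topologicalType) (x : X) (K : Type) :=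
  exists B : set (set X), [/\ B `<=` open_nbhs x,
    \bigcap_(U in B) U = [set x] & B #= [set: K]].

Definition pseudocharacter_at (X : topologicalType) (x : X) : Type :=
  card_min (pseudocharacter_size x).

Definition pseudocharacter (X : topologicalType) : Type :=
  (nat + card_sup [set: X] (@pseudocharacter_at X))%type.

Lemma card_leTP (T U : Type) :
  [set: T] #<= [set: U] <-> exists f : T -> U, injective f.
Proof.
split.
- move=> /card_leP[f].
  pose t (x : T) : [set: T] := SigSub (mem_set (I : [set: T] x)).
  exists (fun x => set_val (f (t x))) => x y /val_inj e.
  have tI z : t z \in [set: [set: T]] by exact: mem_set.
  by have /(congr1 set_val) := 'inj_f (tI x) (tI y) e.
- case=> f fi.
  have : $|{injfun [set: T] >-> [set: U]}|.
    by apply/injfunPex; exists f => // x y _ _; exact: fi.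
  by case=> g; exact: inj_card_le g.
Qed.

Lemma card_le_family_min (I : Type) (i0 : I) (F : I -> Type) :
  exists i, forall j, [set: F i] #<= [set: F j].
Proof.
pose P (S : set (forall i, F i)) :=
  forall x y, S x -> S y -> forall i, x i = y i -> x = y.
have [G GP Gtot|S [PS maxS]] := @Zorn_bigcup _ P.
  move=> x y [A GA Ax] [B GB By] i; have [AB|BA] := Gtot _ _ GA GB.
  - by apply: (GP _ GB) => //; exact: AB.
  - by apply: (GP _ GA) => //; exact: BA.
have [i Si] : exists i, forall a : F i, exists2 x, S x & x i = a.
  apply: contrapT => noi.
  have new i : {a : F i | forall x, S x -> x i <> a}.
    apply: cid; apply: contrapT => na; apply: noi; exists i => a.
    apply: contrapT => nx; apply: na; exists a => x Sx xa.
    by apply: nx; exists x.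
  pose z i := projT1 (new i).
  have zS x : S x -> forall i, x i <> z i.
    by move=> Sx i; exact: (projT2 (new i)).
  apply: (maxS (S `|` [set z])).
    split=> [x Sx|/(_ z (or_intror erefl)) Sz]; first by left.
    exact: (zS z Sz i0).
  move=> x y [Sx|->] [Sy|->] i e //.
  - exact: PS e.
  - by case: (zS x Sx i).
  - by case: (zS y Sy i).
exists i => j; apply/card_leTP.
have /choice[f fP] a : exists x, S x /\ x i = a.
  by have [x] := Si a; exists x.
exists (fun a => f a j) => a b e.
have [[Sa <-] [Sb <-]] := (fP a, fP b).
by rewrite (PS _ _ Sa Sb j e).
Qed.

Lemma card_le_total (T U : Type) :
  [set: T] #<= [set: U] \/ [set: U] #<= [set: T].
Proof.
have [[] b] := card_le_family_min true (fun b : bool => if b then T else U).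
- by left; exact: (b false).
- by right; exact: (b true).
Qed.

Definition card_invariant (P : Type -> Prop) :=
  forall K L : Type, [set: K] #= [set: L] -> P K -> P L.

Lemma is_card_min_ex (P : Type -> Prop) (T : Type) :
  card_invariant P -> P T -> exists K, is_card_min P K.
Proof.
move=> Pinv PT.
pose J := {A : set T | P {x : T | A x}}.
have eq_range (L : Type) (f : L -> T) : injective f ->
    [set: L] #= [set: {x : T | range f x}].
  move=> fi; rewrite card_eq_le; apply/andP; split; apply/card_leTP.
  - exists (fun a => exist _ (f a) (imageT f a)) => a b [].
    exact: fi.
  - have /choice[g gP] (x : {x : T | range f x}) : exists a, f a = sval x.
      by case: x => x /= [a _ <-]; exists a.
    exists g => x y e; apply: eq_sig_hprop; last by rewrite -!gP e.
    by move=> ? ? ?; exact: Prop_irrelevance.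
pose j (L : Type) (PL : P L) f (fi : injective f) : J :=
  exist _ (range f) (Pinv _ _ (eq_range L f fi) PL).
have [[A PA] Amin] :=
  card_le_family_min (j T PT id (@inj_id T)) (fun i => {x : T | sval i x}).
have {}Amin (L : Type) (PL : P L) (f : L -> T) :
    injective f -> [set: {x : T | A x}] #<= [set: L].
  move=> fi; apply: card_le_trans (Amin (j L PL f fi)) _.
  by have := eq_range L f fi; rewrite card_eq_le => /andP[].
exists {x : T | A x}; split=> // L PL.
have [/card_leTP[f]|TL] := card_le_total L T; first exact: Amin.
exact: card_le_trans (Amin T PT id (@inj_id T)) TL.
Qed.

Lemma card_minP (P : Type -> Prop) (T : Type) :
  card_invariant P -> P T -> is_card_min P (card_min P).
Proof.
move=> Pinv PT; rewrite /card_min; case: pselect => [e|[]].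
- exact: projT2 (cid e).
- exact: is_card_min_ex PT.
Qed.

Lemma card_supP (I : Type) (D : set I) (F : I -> Type) :
  is_card_min (fun K => forall i, D i -> [set: F i] #<= [set: K])
    (card_sup D F).
Proof.
apply: (@card_minP _ {i : I & F i}) => [K L|i _].
- by rewrite card_eq_le => /andP[KL _] FK i /FK/card_le_trans; exact.
- apply/card_leTP; exists (existT F i) => x y e.
  by have := projT2_eq e; rewrite (Prop_irrelevance (projT1_eq e) erefl).
Qed.

Lemma UpswP (X : topologicalType) : urysohn_space X ->
  is_card_min (@Upsw_bound X) (card_min (@Upsw_bound X)).
Proof.
move=> hX; apply: (@card_minP _ (set X)) => [K L|].
- rewrite card_eq_le => /andP[KL _] [S [covS SK]].
  by exists S; split=> // x; exact: card_le_trans KL.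
- exists open; split; last by move=> x; exact: card_leT.
  split=> //.
    by apply/seteqP; split=> // x _; exists setT => //; exact: openT.
  move=> x y /hX[U [V [[oU Ux] yV UV0]]]; exists U; split=> // /(_ V yV).
  by rewrite setIC UV0 => -[].
Qed.

Lemma theta_aLP (X : topologicalType) (Y : set X) :
  is_card_min (theta_aL_bound Y) (theta_aL Y).
Proof.
apply: (@card_minP _ (set X)) => [K L|V oV YV].
- rewrite card_eq_le => /andP[KL _] HK V oV YV.
  have [W [WV WK YW]] := HK V oV YV.
  by exists W; split=> //; exact: card_le_trans KL.
- exists V; split=> //; first exact: card_leT.
  move=> x /YV[U VU Ux]; exists U => // N [oN Nx]; exists x.
  by split; exact: subset_closure.
Qed.

Lemma pseudocharacter_atP (X : topologicalType) (x : X) : urysohn_space X ->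
  is_card_min (pseudocharacter_size x) (pseudocharacter_at x).
Proof.
move=> hX; rewrite /pseudocharacter_at.
apply: (@card_minP _ (set_type (open_nbhs x))) => [K L KL [B [Bx IB BK]]|].
  by exists B; split=> //; exact: card_eq_trans KL.
exists (open_nbhs x); split=> //; last first.
  by rewrite card_eq_sym; exact: card_setT.
apply/seteqP; split=> [y xy|_ -> U []//]; apply: contrapT.
move=> /nesym/hX[U [V [xU [oV Vy] UV0]]].
have : set0 y by rewrite -UV0; split; apply: subset_closure => //; exact: xy.
by [].
Qed.

(* Main.v *)
Require Import Defs.
From mathcomp Require Import all_boot all_classical topology.

(** The statement is a cardinal-function inequality proved by a closing-off
    argument.  Write [K] for the exponent, [T] for [Upsw X], and let [S] be a
    Urysohn point separating open cover in which each point of [X] lies in at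
    most [T] members, enumerated as [e x t].

    Density.  Start from a point and close off under the operation that takes
    [K] points [x k] and [K] labels [t k], and returns a point outside the union
    of the sets [cl_theta (closure (e (x k) (t k)))], if there is one.  The
    resulting set [H] is dense ([range_grow_dense]).  Otherwise some [p] is
    outside [closure H]; each point of [closure H] lies in a member [U] of [S]
    with [p] outside [cl_theta (closure U)], and [K] of the sets
    [cl_theta (closure U)] cover [closure H].  These [U] are open and meet
    [closure H], hence meet [H], so they have the form [e (x k) (t k)] with
    [x k] in [H]; the operation then returned a point of [H] outside a cover of
    [closure H].  It follows that [S] has no more members than [H * T].

    Coding.  Given [x], the complement of [{x}] is a union of [K] closed sets
    [~` B], where [B] runs over a pseudobase at [x]; each of them is covered by
    [K] sets [cl_theta (closure U)], [U] in [S], that miss [x].  So [x] is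
    determined by a family of members of [S] indexed by [K * K].

    Counting.  Instead of a transfinite recursion of length the successor of
    [K], which would call for ordinals and regularity, [H] is the image of the
    inductive type [tree] of well-founded [K]-branching trees labelled by [T].
    A tree is determined by its labels along finite paths, i.e. by a function
    from [seq K] to [K -> T] ([code_tree_inj]).  Everything then reduces to
    injections [seq K -> K] and [T * T -> T], which come from the fact that an
    infinite type contains a copy of its square ([infinite_pairing]), by Zorn's
    lemma. *)

Set Implicit Arguments.
Unset Strict Implicit.
Unset Printing Implicit Defensive.

Local Open Scope classical_set_scope.
Local Open Scope card_scope.

(** * Infinite types and their squares *)

Definition injective_pairing (T : Type) (p : T -> T -> T) :=
  forall x y x' y', p x y = p x' y' -> x = x' /\ y = y'.

Definition pairing_on (T : Type) (A : set T) (q : T -> T -> T) :=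
  (forall x y, A x -> A y -> A (q x y)) /\
  (forall x y x' y', A x -> A y -> A x' -> A y' ->
     q x y = q x' y' -> x = x' /\ y = y').

(** Only the restriction of [q] to [A] matters, so this is a preorder and not
    an order: a pairing is a total function with junk values off [A]. *)
Definition pairing_extends (T : Type) (P Q : set T * (T -> T -> T)) :=
  P.1 `<=` Q.1 /\ forall x y, P.1 x -> P.1 y -> Q.2 x y = P.2 x y.

Lemma pairing_chain_bound (T : Type)
    (F : set (set T * (T -> T -> T))) (P0 : set T * (T -> T -> T)) :
  F P0 -> (forall P, F P -> pairing_on P.1 P.2) ->
  total_on F (@pairing_extends T) ->
  exists2 Q, pairing_on Q.1 Q.2 & forall P, F P -> pairing_extends P Q.
Proof.
move=> FP0 Fpair Ftot.
pose A : set T := \bigcup_(P in F) P.1.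
have common2 P Q : F P -> F Q ->
    exists R, [/\ F R, pairing_extends P R & pairing_extends Q R].
  have refl R : pairing_extends R R by split.
  by move=> FP FQ; have [PQ|QP] := Ftot _ _ FP FQ; [exists Q|exists P].
have common x y : A x -> A y -> exists R, [/\ F R, R.1 x & R.1 y].
  move=> [P FP Px] [Q FQ Qy]; have [R [FR [PR _] [QR _]]] := common2 _ _ FP FQ.
  by exists R; split=> //; [exact: PR|exact: QR].
have /choice[r rP] (xy : T * T) : exists R, A xy.1 -> A xy.2 ->
    [/\ F R, R.1 xy.1 & R.1 xy.2].
  have [[Ax Ay]|nA] := pselect (A xy.1 /\ A xy.2).
    by have [R ?] := common _ _ Ax Ay; exists R.
  by exists P0 => Ax Ay; case: nA.
pose q x y := (r (x, y)).2 x y.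
have qE P x y : F P -> P.1 x -> P.1 y -> q x y = P.2 x y.
  move=> FP Px Py.
  have [|| /= Fr rx ry] := rP (x, y); [by exists P|by exists P|].
  have [R [_ [_ PR] [_ rR]]] := common2 _ _ FP Fr.
  by rewrite /q -rR // -PR.
exists (A, q) => [|P FP]; last by split=> [x Px|x y]; [exists P|exact: qE].
split=> /= [x y Ax Ay|x y x' y' Ax Ay Ax' Ay'].
- have [R [FR Rx Ry]] := common _ _ Ax Ay; exists R => //.
  by have [RA _] := Fpair _ FR; rewrite (qE R) //; exact: RA.
- have [P [FP Px Py]] := common _ _ Ax Ay.
  have [Q [FQ Qx Qy]] := common _ _ Ax' Ay'.
  have [R [FR [PR _] [QR _]]] := common2 _ _ FP FQ.
  have [[[Rx Ry] Rx'] Ry'] := (PR _ Px, PR _ Py, QR _ Qx, QR _ Qy).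
  by have [_ Ri] := Fpair _ FR; rewrite !(qE R) //; exact: Ri.
Qed.

(** If the complement of [A] contains a copy [j @` A] of [A], the three new
    blocks of the square of [A `|` j @` A] all fit in that copy: a pair is sent
    to [j] of a code of its two underlying points, tagged by its block. *)
Lemma pairing_double (T : Type) (A : set T) (q : T -> T -> T) (p0 p1 : T)
    (j : T -> T) :
  p0 <> p1 -> A p0 -> A p1 -> pairing_on A q ->
  (forall x, A x -> ~ A (j x)) ->
  (forall x y, A x -> A y -> j x = j y -> x = y) ->
  exists Q, [/\ pairing_on Q.1 Q.2, pairing_extends (A, q) Q &
    exists2 z, Q.1 z & ~ A z].
Proof.
move=> p01 Ap0 Ap1 [qA qi] jA ji.
pose A' : set T := A `|` j @` A.
have /choice[r rP] x : exists y,
    A' x -> A y /\ (if `[< A x >] then x = y else x = j y).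
  have [[Ax|[y Ay <-]]|nA] := pselect (A' x); last by exists x.
    by exists x; rewrite asboolT.
  by exists y => _; rewrite asboolF //; exact: jA.
pose d (b : bool) := if b then p1 else p0.
have dA b : A (d b) by case: b.
have di b c : d b = d c -> b = c by case: b; case: c => // /esym.
pose tag x := d `[< A x >].
pose q' x y := if `[< A x >] && `[< A y >] then q x y
               else j (q (q (tag x) (tag y)) (q (r x) (r y))).
have rA x : A' x -> A (r x) by move=> /rP[].
have codeA x y : A' x -> A' y -> A (q (q (tag x) (tag y)) (q (r x) (r y))).
  by move=> /rA rx /rA ry; apply/qA; apply/qA => //; exact: dA.
have recover x x' : A' x -> A' x' -> tag x = tag x' -> r x = r x' -> x = x'.
  move=> /rP[_ xE] /rP[_ x'E] /di txx' rxx'.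
  by move: xE x'E; rewrite -txx' rxx'; case: asbool => xE x'E; rewrite xE -x'E.
exists (A', q'); split => /=.
- split=> [x y A'x A'y|x y x' y' A'x A'y A'x' A'y'] /=; rewrite /q'.
    case: ifPn => [/andP[/asboolP Ax /asboolP Ay]|_]; first by left; exact: qA.
    by right; exists (q (q (tag x) (tag y)) (q (r x) (r y))) => //; exact: codeA.
  have [Axy Axy'] := (codeA _ _ A'x A'y, codeA _ _ A'x' A'y').
  case: ifPn => [/andP[/asboolP Ax /asboolP Ay]|_];
    case: ifPn => [/andP[/asboolP Ax' /asboolP Ay']|_].
  + exact: qi.
  + by move=> e; case: (jA _ Axy'); rewrite -e; exact: qA.
  + by move=> e; case: (jA _ Axy); rewrite e; exact: qA.
  + move=> /(ji _ _ Axy Axy'); have [[[rx ry] rx'] ry'] :=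
      (rA _ A'x, rA _ A'y, rA _ A'x', rA _ A'y').
    have tA z : A (tag z) by exact: dA.
    case/qi; do ?exact: qA.
    by case/qi => // tx ty /qi[] // ? ?; split; exact: recover.
- by split=> [x|x y Ax Ay]; [left|rewrite /= /q' !asboolT].
- by exists (j p0); [right; exists p0|exact: jA].
Qed.

(** If the complement of [A] embeds in [A], then so does the whole type, and
    a pairing on [A] pulls back. *)
Lemma pairing_absorb (T : Type) (A : set T) (q : T -> T -> T) (p0 p1 : T)
    (g : T -> T) :
  p0 <> p1 -> A p0 -> A p1 -> pairing_on A q ->
  (forall x, ~ A x -> A (g x)) ->
  (forall x y, ~ A x -> ~ A y -> g x = g y -> x = y) ->
  exists p : T -> T -> T, injective_pairing p.
Proof.
move=> p01 Ap0 Ap1 [qA qi] gA gi.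
pose h x := if pselect (A x) then q p0 x else q p1 (g x).
have hA x : A (h x) by rewrite /h; case: pselect => ?; apply: qA => //; exact: gA.
have hi : injective h.
  move=> x y; rewrite /h; case: pselect => Ax; case: pselect => Ay.
  - by case/qi.
  - by case/qi => //; exact: gA.
  - by case/qi => //; [exact: gA|move/esym].
  - by case/qi; [| exact: gA | | exact: gA | move=> _; exact: gi].
exists (fun x y => q (h x) (h y)) => x y x' y'.
by case/qi => // /hi-> /hi->.
Qed.

(** A pairing that is maximal among those whose domain contains the copy of
    [nat] lives on a set that cannot embed in its own complement, hence
    contains a copy of its complement by comparability. *)
Lemma infinite_pairing (T : Type) :
  [set: nat] #<= [set: T] -> exists p : T -> T -> T, injective_pairing p.
Proof.
move=> /card_leTP[i ii].
have /choice[u uP] x : exists n, range i x -> i n = x.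
  have [[n _ nx]|nx] := pselect (range i x); first by exists n.
  by exists 0.
have uK n : u (i n) = n by apply: ii; apply: uP; exact: imageT.
pose q0 x y := i (pickle (u x, u y)).
have q0P : pairing_on (range i) q0.
  split=> [x y _ _|_ _ _ _ [m _ <-] [n _ <-] [m' _ <-] [n' _ <-]].
    exact: imageT.
  by rewrite /q0 !uK => /ii/(pcan_inj pickleK)[-> ->].
pose J := {P : set T * (T -> T -> T) | pairing_on P.1 P.2 /\ range i `<=` P.1}.
pose J0 : J := exist _ (range i, q0) (conj q0P (@subset_refl _ _)).
pose R (P Q : J) := `[< pairing_extends (sval P) (sval Q) >].
have [||F Ftot|[[A q] /= [qP iA]] maxA] := ZL_preorder J0 (R := R).
- by move=> P; apply/asboolP; split.
- move=> P Q S /asboolP[QP eQP] /asboolP[PS ePS]; apply/asboolP.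
  split=> [|x y Qx Qy]; first exact: subset_trans PS.
  by rewrite ePS ?eQP //; exact: QP.
- have [[P0 FP0]|F0] := pselect (F !=set0); last first.
    by exists J0 => P FP; case: F0; exists P.
  have [||| Q QP FQ] := @pairing_chain_bound T (sval @` F) (sval P0).
  + by exists P0.
  + by move=> _ [P _ <-]; case: (svalP P).
  + move=> _ _ [P FP <-] [Q FQ <-].
    by have [/asboolP|/asboolP] := Ftot _ _ FP FQ; [left|right].
  have iQ : range i `<=` Q.1.
    apply: subset_trans (proj2 (svalP P0)) _.
    by apply: (proj1 (FQ _ _)); exists P0.
  by exists (exist _ Q (conj QP iQ)) => P FP; apply/asboolP; apply: FQ; exists P.
have [A0 A1] : A (i 0) /\ A (i 1) by split; apply/iA; exact: imageT.
have i01 : i 0 <> i 1 by move/ii.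
(* injections between subtypes, as functions on the ambient type *)
have ext (B C : set T) : [set: {x | B x}] #<= [set: {x | C x}] ->
    exists g : T -> T, (forall x, B x -> C (g x)) /\
      (forall x y, B x -> B y -> g x = g y -> x = y).
  move=> /card_leTP[f fi].
  pose g x := if pselect (B x) is left Bx then sval (f (exist _ x Bx)) else x.
  exists g; split=> [x Bx|x y Bx By]; rewrite /g; case: pselect => // Bx'.
    exact: svalP.
  case: pselect => // By' fxy.
  suff /fi[] : f (exist _ x Bx') = f (exist _ y By') by [].
  by apply: eq_sig_hprop fxy => ? ? ?; exact: Prop_irrelevance.
have [/ext[g [gA gi]]|/ext[j [jA ji]]] :=
  card_le_total {x | (~` A) x} {x | A x}.
  exact: (pairing_absorb i01 A0 A1 qP gA gi).
have [Q [QP AQ [z Qz nAz]]] := pairing_double i01 A0 A1 qP jA ji.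
have iQ : range i `<=` Q.1 by apply: (subset_trans iA); case: AQ.
have /asboolP[/= QA _] := maxA (exist _ Q (conj QP iQ)) (asboolT AQ).
by case: nAz; exact: QA.
Qed.

(** The length has to be recorded because the pairing need not be
    well-founded: iterated pairs of different depths may coincide. *)
Lemma seq_card_le (K : Type) :
  [set: nat] #<= [set: K] -> [set: seq K] #<= [set: K].
Proof.
move=> natK; have [p pi] := infinite_pairing natK.
have /card_leTP[i ii] := natK; apply/card_leTP.
exists (fun s => p (i (size s)) (foldr p (i 0) s)) => s s' /pi[/ii].
by elim: s s' => [|x s IH] [|y s'] //= [/IH{}IH] /pi[-> /IH->].
Qed.

(** * Well-founded trees *)

Inductive tree (K T : Type) := Leaf | Node of (K -> tree K T) & (K -> T).
Arguments Leaf {K T}.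

(** [p t0 _] marks a leaf and [p t1 _] an inner node. *)
Fixpoint code_tree (K T : Type) (p : T -> T -> T) (t0 t1 : T) (tr : tree K T)
    (s : seq K) (k : K) : T :=
  match tr, s with
  | Leaf, _ => p t0 t0
  | Node _ g, [::] => p t1 (g k)
  | Node f _, l :: s' => code_tree p t0 t1 (f l) s' k
  end.

Lemma code_tree_inj (K T : Type) (p : T -> T -> T) (t0 t1 : T) (k0 : K) :
  injective_pairing p -> t0 <> t1 -> injective (@code_tree K T p t0 t1).
Proof.
move=> pi t01; elim=> [|f IH g] [|f' g'] // e.
- by have /pi[/t01] := congr1 (fun F => F [::] k0) e.
- by have /pi[/esym/t01] := congr1 (fun F => F [::] k0) e.
- congr Node; apply/funext => k.
    by apply: IH; apply/funext => s; exact: (congr1 (fun F => F (k :: s)) e).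
  by have /pi[] := congr1 (fun F => F [::] k) e.
Qed.

(** The cardinal identity [((T ^ K) * T) ^ (K * K) = T ^ K], with trees
    standing for [T ^ K]. *)
Lemma fun_tree_card_le (K T : Type) :
  [set: nat] #<= [set: K] -> [set: nat] #<= [set: T] ->
  [set: K * K -> tree K T * T] #<= [set: K -> T].
Proof.
move=> natK natT; have [p pi] := infinite_pairing natT.
have /card_leTP[c ci] := seq_card_le natK.
have /card_leTP[iK _] := natK; have /card_leTP[iT iTi] := natT.
pose k0 := iK 0; pose t0 := iT 0; pose t1 := iT 1.
have t01 : t0 <> t1 by move/iTi.
have /choice[d dP] k : exists s, forall s', c s' = k -> s = s'.
  have [[s sk]|nk] := pselect (exists s, c s = k).
    by exists s => s' s'k; apply: ci; rewrite sk s'k.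
  by exists [::] => s' s'k; case: nk; exists s'.
have dK s : d (c s) = s by exact: dP.
pose G (F : K * K -> tree K T * T) (l : seq K) :=
  if l is [:: a, b, k & s] then
    p (code_tree p t0 t1 (F (a, b)).1 s k) (F (a, b)).2 else t0.
apply/card_leTP; exists (fun F k => G F (d k)) => F F' e.
have GE l : G F l = G F' l by have := congr1 (@^~ (c l)) e; rewrite dK.
apply/funext => -[a b].
have GE' s k := pi _ _ _ _ (GE [:: a, b, k & s]).
have trE : (F (a, b)).1 = (F' (a, b)).1.
  apply: (code_tree_inj k0 pi t01); apply/funext => s; apply/funext => k.
  by have [] := GE' s k.
have [_ tE] := GE' [::] k0.
by rewrite [LHS]surjective_pairing trE tE -surjective_pairing.
Qed.

(** * Enumerations by types *)

(** The default value [d] covers the case of an empty [A]. *)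
Lemma card_le_enum (T K : Type) (A : set T) (d : T) : A #<= [set: K] ->
  exists w : K -> T, (forall k, A (w k) \/ w k = d) /\
    forall x, A x -> exists k, w k = x.
Proof.
move=> AK; have /card_leTP[f fi] : [set: set_type A] #<= [set: K].
  by apply: card_le_trans AK; have := card_setT A; rewrite card_eq_le => /andP[].
have /choice[w wP] k : exists y, (A y \/ y = d) /\
    forall a : set_type A, f a = k -> y = val a.
  have [[a ak]|nk] := pselect (exists a, f a = k); last first.
    by exists d; split=> [|a ak]; [right|case: nk; exists a].
  exists (val a); split=> [|b bk]; first by left; exact: set_valP.
  by congr val; apply: fi; rewrite ak bk.
exists w; split=> [k|x Ax]; first by case: (wP k).
exists (f (SigSub (mem_set Ax))).
by have [_ /(_ _ erefl)] := wP (f (SigSub (mem_set Ax))).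
Qed.

(** * Density of the closed-off set and the coding of points *)

Lemma theta_closure_closure0 (X : topologicalType) :
  theta_closure (closure (set0 : set X)) = set0.
Proof.
rewrite closure0; apply/seteqP; split=> // x /(_ setT) [|y [_ //]].
by split=> //; exact: openT.
Qed.

Section bound.
Variables (X : topologicalType) (K T : Type) (S : set (set X)).
Variables (e : X -> T -> set X).
Hypothesis coverS : urysohn_point_separating_open_cover S.
Hypothesis eP : forall x U, S U /\ U x \/ U = set0 -> exists t, e x t = U.
Hypothesis aLP : forall C : set X, closed C -> forall V : set (set X),
  V `<=` open -> C `<=` \bigcup_(U in V) U ->
  exists w : K -> set X, (forall k, V (w k) \/ w k = set0) /\
    C `<=` \bigcup_k theta_closure (closure (w k)).
Hypothesis psiP : forall x : X, exists b : K -> set X,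
  (forall k, open_nbhs x (b k)) /\ forall y, y <> x -> exists k, ~ b k y.

(** Members of [S] that avoid [x] in the strong sense cover every closed set
    that misses [x], because [S] separates points. *)
Lemma separating_family (x : X) (C : set X) : closed C -> ~ C x ->
  exists w : K -> set X,
    [/\ forall k, S (w k) /\ w k `&` C !=set0 \/ w k = set0,
        forall k, ~ theta_closure (closure (w k)) x &
        C `<=` \bigcup_k theta_closure (closure (w k))].
Proof.
move=> clC nCx; have [openS _ sepS] := coverS.
pose V := [set U | [/\ S U, U `&` C !=set0 & ~ theta_closure (closure U) x]].
have [U [SU _ _]|y Cy|w [wV Cw]] := aLP clC (V := V).
- exact: openS.
- have [|U [SU Uy Ux]] := sepS y x; first by move=> yx; apply: nCx; rewrite -yx.
  by exists U => //; split=> //; exists y.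
- exists w; split=> // k; case: (wV k) => [[SU UC Ux]//|->].
  + by left.
  + by right.
  + by rewrite theta_closure_closure0.
Qed.

Variable x0 : X.

(** The closing-off operation on [K] points and [K] labels, with [x0] as the
    value when there is no point outside. *)
Definition escape_point (x : K -> X) (t : K -> T) : X :=
  xget x0 (~` \bigcup_k theta_closure (closure (e (x k) (t k)))).

Fixpoint grow (tr : tree K T) : X :=
  match tr with
  | Leaf => x0
  | Node f g => escape_point (fun k => grow (f k)) g
  end.

Lemma range_grow_dense : closure (range grow) = setT.
Proof.
apply/seteqP; split=> // p _; apply: contrapT => np.
have [openS _ _] := coverS.
have [w [wS wp Hw]] := separating_family (@closed_closure _ (range grow)) np.
have /choice[f fP] k : exists ft, e (grow ft.1) ft.2 = w k.
  case: (wS k) => [[Sw [y [wy Hy]]]|w0]; last first.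
    have [t tw] : exists t, e x0 t = w k by apply: eP; right.
    by exists (Leaf, t).
  (* an open set that meets the closure of [range grow] meets [range grow] *)
  have [_ [[tr _ <-] wtr]] : range grow `&` w k !=set0.
    by apply: Hy; apply: open_nbhs_nbhs; split=> //; exact: openS.
  have [t tw] : exists t, e (grow tr) t = w k by apply: eP; left.
  by exists (tr, t).
pose tr := Node (fun k => (f k).1) (fun k => (f k).2).
have : (~` \bigcup_k theta_closure (closure (w k))) (grow tr).
  rewrite /= /escape_point.
  have -> : \bigcup_k theta_closure (closure (e (grow (f k).1) (f k).2)) =
            \bigcup_k theta_closure (closure (w k)).
    by apply: eq_bigcupr => k _; rewrite fP.
  by apply: (@xgetPex _ x0 (~` _)); exists p => -[k _]; exact: wp.
by apply; apply: Hw; apply: subset_closure; exact: imageT.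
Qed.

Lemma member_grow (U : set X) : S U \/ U = set0 ->
  exists ft : tree K T * T, e (grow ft.1) ft.2 = U.
Proof.
have [openS _ _] := coverS.
have [[y Uy]|U0] := pselect (U !=set0).
- case=> [SU|U0]; last by rewrite U0 in Uy.
  have : closure (range grow) y by rewrite range_grow_dense.
  case/(_ U); first by apply: open_nbhs_nbhs; split=> //; exact: openS.
  move=> _ [[tr _ <-] Utr].
  have [t tU] : exists t, e (grow tr) t = U by apply: eP; left.
  by exists (tr, t).
- move=> _; have [t tU] : exists t, e x0 t = U.
    by apply: eP; right; apply/seteqP; split=> // y Uy; case: U0; exists y.
  by exists (Leaf, t).
Qed.

Lemma point_code_card_le : [set: X] #<= [set: K * K -> tree K T * T].
Proof.
have /choice[c cP] x : exists c : K * K -> tree K T * T,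
    (forall k, ~ theta_closure (closure (e (grow (c k).1) (c k).2)) x) /\
    forall y, y <> x ->
      exists k, theta_closure (closure (e (grow (c k).1) (c k).2)) y.
  have [b [bx bsep]] := psiP x.
  have /choice[w wP] k : exists w : K -> set X,
      [/\ forall l, S (w l) \/ w l = set0,
          forall l, ~ theta_closure (closure (w l)) x &
          ~` b k `<=` \bigcup_l theta_closure (closure (w l))].
    have [ob bkx] := bx k.
    have [||w [wS wx Cw]] := @separating_family x (~` b k).
    - exact: open_closedC.
    - by apply.
    - by exists w; split=> // l; case: (wS l) => [[]|]; [left|right].
  have /choice[c cP] (k : K * K) :
      exists ft : tree K T * T, e (grow ft.1) ft.2 = w k.1 k.2.
    by apply: member_grow; have [] := wP k.1.
  exists c; split=> [k|y /bsep[k nby]]; first by rewrite cP; have [] := wP k.1.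
  have [_ _ /(_ y nby)[l _ yl]] := wP k.
  by exists (k, l); rewrite cP.
apply/card_leTP; exists c => x y cxy; apply: contrapT => nxy.
have [_ /(_ y (nesym nxy))[k]] := cP x.
by rewrite cxy; have [/(_ k)] := cP y.
Qed.

End bound.

Theorem theorem4p2 (X : topologicalType) (hX : urysohn_space X) :
  [set: X] #<= [set: theta_aLc X * pseudocharacter X -> Upsw X].
Proof.
have [x0|noX] := pselect (inhabited X); last first.
  apply/card_leTP; exists (fun x => False_rect _ (noX (inhabits x))) => x.
  by case: (noX (inhabits x)).
case: x0 => x0.
pose K := (theta_aLc X * pseudocharacter X)%type.
have natK : [set: nat] #<= [set: K].
  by apply/card_leTP; exists (fun n => (inl n, inl 0)) => m n [].
have natT : [set: nat] #<= [set: Upsw X].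
  by apply/card_leTP; exists inr => m n [].
have [[S [coverS ST]] _] := UpswP hX.
have /choice[e eP] x : exists e : Upsw X -> set X,
    forall U, S U /\ U x \/ U = set0 -> exists t, e t = U.
  have [w [_ wP]] := card_le_enum set0 (ST x).
  exists (fun t => if t is inl t' then w t' else set0) => U.
  by move=> [/wP[t <-]|->]; [exists (inl t)|exists (inr 0)].
have aLK (C : set X) : closed C -> [set: theta_aL C] #<= [set: K].
  move=> clC; have [supC _] := card_supP [set C : set X | closed C] (@theta_aL X).
  apply: card_le_trans (supC C clC) _; apply/card_leTP.
  by exists (fun a => (inr a, inl 0)) => a b [].
have psiK (x : X) : [set: pseudocharacter_at x] #<= [set: K].
  have [supx _] := card_supP [set: X] (@pseudocharacter_at X).
  apply: card_le_trans (supx x I) _; apply/card_leTP.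
  by exists (fun a => (inl 0, inr a)) => a b [].
apply: card_le_trans (fun_tree_card_le natK natT).
apply: (point_code_card_le coverS eP) => // [C clC V oV CV|x].
- have [aL _] := theta_aLP C; have [W [WV WK CW]] := aL V oV CV.
  have [w [wW Ww]] := card_le_enum set0 (card_le_trans WK (aLK C clC)).
  exists w; split=> [k|y /CW[U /Ww[k <-] Uy]]; last by exists k.
  by case: (wW k) => [/WV|]; [left|right].
- have [[B [Bx capB BK]] _] := pseudocharacter_atP x hX.
  have {}BK : B #<= [set: K].
    apply: card_le_trans (psiK x).
    by move: BK; rewrite card_eq_le => /andP[].
  have [b [bB Bb]] := card_le_enum setT BK.
  exists b; split=> [k|y yx].
    case: (bB k) => [/Bx//|->]; split=> //; exact: openT.
  apply: contrapT => nb; apply: yx.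
  have : [set x] y; last by [].
  rewrite -capB => U /Bb[k <-]; apply: contrapT => nby.
  by apply: nb; exists k.
Qed.
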